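(* For any integer $m\geq 1$, there exist a simplicial $(4m+2)$-polytope $P\subset\mathbb{R}^{4m+2}$ with $\partial P\in S(2m,4m+1)$, and a $2m$-face of $P$ that does not participate in any affine $(2m+1)$-stress on $(\partial P,p)$, where $p$ is the natural embedding of $\partial P$.
   Context: A missing face of a simplicial complex is a set of vertices that is not a face but all of whose proper subsets are faces; its dimension is its cardinality minus $1$. $S(j,d-1)$ denotes the set of $\mathbb{Z}/2\mathbb{Z}$-homology $(d-1)$-spheres all of whose missing faces have dimension at most $j$ (boundary complexes of simplicial $d$-polytopes are such spheres of dimension $d-1$). $\partial P$ is the boundary complex of the simplicial polytope $P$, an abstract simplicial complex on the vertices of $P$. Its natural embedding $p$ sends each vertex to its position vector in $\mathbb{R}^d$ ($d=\dim P$). Let $\Delta$ be a $(d-1)$-dimensional simplicial complex with vertex set $V$ and $p:V\to\mathbb{R}^d$. In $\mathbb{R}[x_v:v\in V]$, let $\theta_j=\sum_v p(v)_jx_v$ ($1\le j\le d$) and $c=\sum_v x_v$; for a linear form $\ell=\sum\ell_vx_v$ let $\partial_\ell=\sum_v\ell_v\,\partial/\partial x_v$. An affine $k$-stress on $(\Delta,p)$ is a homogeneous polynomial $\lambda\in\mathbb{R}[x_v:v\in V]$ of degree $k$ such that every monomial $\mu$ appearing in $\lambda$ with nonzero coefficient has support $\mathrm{supp}(\mu)=\{v:x_v\mid\mu\}\in\Delta$, $\partial_{\theta_i}\lambda=0$ for all $i=1,\dots,d$, and $\partial_c\lambda=0$. A face $\tau$ participates in a stress $\omega$ if some monomial $\mu$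 with nonzero coefficient in $\omega$ satisfies $\tau\subseteq\mathrm{supp}(\mu)$. *)

(* Defs.v *)
From HB Require Import structures.
From mathcomp Require Import all_boot all_order all_algebra.
From mathcomp Require Import boolp classical_sets reals.
From mathcomp Require Import mpoly.

Set Implicit Arguments.
Unset Strict Implicit.
Unset Printing Implicit Defensive.

Import Order.TTheory GRing.Theory Num.Theory.

Local Open Scope ring_scope.

(** * Simplicial complexes

    A complex is a finite set of finite sets, containing the empty face; a face
    [s] has dimension [#|s| - 1].  Elements of the ground type [T] need not be
    vertices (links live on the same ground type); the vertices are
    [cover K], the union of all faces. *)

Section Complexes.
Variable T : finType.
Implicit Types (K : {set {set T}}) (s t : {set T}).

Definition simplicial_complex K : Prop :=
  finset.set0 \in K /\ (forall s t, t \in K -> s \subset t -> s \in K).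

Definition link K s : {set {set T}} :=
  [set t : {set T} | [disjoint s & t] && (s :|: t \in K)].

Definition missing_face K s : Prop :=
  [/\ s \subset finset.cover K, s \notin K & forall t, t \proper s -> t \in K].

(** Reduced simplicial homology over Z/2.  Chains of all degrees live in one
    space, and are indexed by the cardinality [k] of the faces: [k] stands for
    homological degree [k - 1], so [k = 0] is the augmentation degree [-1]. *)

Definition chain_space := {ffun {set T} -> ('F_2)^o}.

(* the coefficient of s in the boundary is the sum of the coefficients of the
   sets having s as a facet *)
Definition bdry_fun (c : chain_space) : chain_space :=
  [ffun s : {set T} => \sum_(x | x \notin s) c (x |: s)].

Fact bdry_fun_is_linear : linear bdry_fun.
Proof.
move=> a c c'; apply/ffunP => s; rewrite !ffunE scaler_sumr -big_split /=.
by apply: eq_bigr => x _; rewrite !ffunE.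
Qed.

HB.instance Definition _ :=
  GRing.isLinear.Build 'F_2 chain_space chain_space *:%R bdry_fun
    bdry_fun_is_linear.

Definition bdry : 'End(chain_space) := linfun bdry_fun.

Definition elementary_chain s : chain_space := [ffun t : {set T} => (t == s)%:R].

Definition chains K (k : nat) : {vspace chain_space} :=
  <<[seq elementary_chain s | s in [set s in K | #|s| == k]]>>%VS.

Definition cycles K k : {vspace chain_space} := (chains K k :&: lker bdry)%VS.

Definition boundaries K k : {vspace chain_space} := (bdry @: chains K k.+1)%VS.

(* the dimension of the reduced homology group in degree k - 1 *)
Definition reduced_betti K k : nat := (\dim (cycles K k) - \dim (boundaries K k))%N.

(** [K] is an [e]-dimensional Z/2-homology sphere: the link of each face [s],
    the empty one included, has the reduced homology of a sphere of dimension
    [e - #|s|]. *)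
Definition homology_sphere (e : nat) K : Prop :=
  [/\ simplicial_complex K,
      \max_(s in K) #|s| = e.+1 &
      forall s, s \in K -> forall k : nat,
        reduced_betti (link K s) k = (k == e.+1 - #|s|)%N].

(* S(j, e) *)
Definition in_S (j e : nat) K : Prop :=
  homology_sphere e K /\ (forall s, missing_face K s -> (#|s|.-1 <= j)%N).

End Complexes.

(** * Convex polytopes *)

Section Polytopes.
Variables (R : realType) (d : nat).
Implicit Types P F : set 'rV[R]_d.

Definition conv_hull (n : nat) (q : 'I_n -> 'rV[R]_d) : set 'rV[R]_d :=
  [set x | exists w : 'I_n -> R,
     [/\ forall i, 0 <= w i, \sum_i w i = 1 & x = \sum_i w i *: q i]]%classic.

Definition affinely_independent (n : nat) (q : 'I_n -> 'rV[R]_d) : Prop :=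
  forall w : 'I_n -> R,
    \sum_i w i = 0 -> \sum_i w i *: q i = 0 -> forall i, w i = 0.

Definition polytope P : Prop :=
  exists n (q : 'I_n -> 'rV[R]_d), P = conv_hull q.

Definition has_dim P (e : nat) : Prop :=
  (exists q : 'I_e.+1 -> 'rV[R]_d,
     (forall i, P (q i)) /\ affinely_independent q) /\
  (forall q : 'I_e.+2 -> 'rV[R]_d,
     (forall i, P (q i)) -> ~ affinely_independent q).

(* Both the empty set and P itself are faces (take a = 0, b = 1 or b = 0). *)
Definition is_face P F : Prop :=
  exists (a : 'cV[R]_d) (b : R),
    (forall x, P x -> (x *m a) 0 0 <= b) /\
    F = [set x | P x /\ (x *m a) 0 0 = b]%classic.

Definition proper_face P F : Prop := is_face P F /\ F <> P.

Definition is_simplex F : Prop :=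
  exists n (q : 'I_n -> 'rV[R]_d), affinely_independent q /\ F = conv_hull q.

Definition simplicial_polytope P : Prop :=
  polytope P /\ (forall F, proper_face P F -> is_simplex F).

Definition vertices P : set 'rV[R]_d := [set v | is_face P [set v]]%classic.

(** The vertex set of [P] is indexed by ['I_n]; [p] sends an index to the
    position vector of the corresponding vertex. *)
Definition natural_embedding P (n : nat) (p : 'I_n -> 'rV[R]_d) : Prop :=
  injective p /\ range p = vertices P.

(* the vertex sets of the proper faces of P *)
Definition boundary_complex P (n : nat) (p : 'I_n -> 'rV[R]_d)
    : {set {set 'I_n}} :=
  [set s : {set 'I_n} |
    `[< exists2 F, proper_face P F & forall i, i \in s <-> F (p i) >]].

End Polytopes.

(** * Affine stresses *)

Section Stresses.
Variables (R : realType) (n : nat).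
Implicit Types (K : {set {set 'I_n}}) (f l : {mpoly R[n]}).

Definition monomial_support (mu : 'X_{1..n}) : {set 'I_n} :=
  [set v | mu v != 0%N].

(* differentiation along the linear form l = \sum_v l_v x_v *)
Definition partial l f : {mpoly R[n]} := \sum_(v < n) l@_U_(v) *: mderiv v f.

Definition theta (d : nat) (p : 'I_n -> 'rV[R]_d) (j : 'I_d) : {mpoly R[n]} :=
  \sum_(v < n) p v 0 j *: 'X_v.

Definition sum_of_variables : {mpoly R[n]} := \sum_(v < n) 'X_v.

Definition affine_stress K (d : nat) (p : 'I_n -> 'rV[R]_d) (k : nat) f : Prop :=
  [/\ f \is k.-homog,
      forall mu, mu \in msupp f -> monomial_support mu \in K,
      forall j, partial (theta p j) f = 0 &
      partial sum_of_variables f = 0].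

Definition participates (tau : {set 'I_n}) f : Prop :=
  exists2 mu, mu \in msupp f & tau \subset monomial_support mu.

End Stresses.

(* Main.v *)
Require Import Defs.
From mathcomp Require Import all_boot all_order all_algebra.
From mathcomp Require Import boolp classical_sets reals.
From mathcomp Require Import mpoly.
(* Imported again so that the names shared with classical_sets denote finite
   sets. *)
From mathcomp Require Import finset.
From mathcomp Require Import zify ring lra.

(** P is the free sum of two 2m-simplices and a triangle, each containing the
    origin in its interior, so that its boundary is the join of the boundaries
    of the three simplices: a set of vertices is a face iff it contains none of
    the three blocks of vertices.  The derivatives of an affine stress f along
    the vertices of one block all coincide; call them D_0, D_1, D_2.  For
    i + j + l = 2m + 1 the numbers G(i,j,l) = D_0^i D_1^j D_2^l f satisfy
      (2m+1) (G(i+1,j,l) + G(i,j+1,l)) + 3 G(i,j,l+1) = 0,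
    and G(2m+1,0,0) = G(0,2m+1,0) = G(i,j,3) = 0 because the blocks are not
    faces.  This forces G(m,m,1) = 0, so a face with m vertices in each large
    block and one in the triangle does not participate in f. *)

Set Implicit Arguments.
Unset Strict Implicit.
Unset Printing Implicit Defensive.

Import Order.TTheory GRing.Theory Num.Theory.

Local Open Scope ring_scope.

(** * Homology of joins of boundaries of simplices *)

Section Homology.
Variable T : finType.
Implicit Types (K : {set {set T}}) (s t A : {set T}) (c e z : chain_space T).

Lemma addrr_F2 (x : 'F_2) : x + x = 0.
Proof. by apply: addrr_pchar2; rewrite pchar_Fp. Qed.

Lemma addr0_eq_F2 (x y : 'F_2) : x + y = 0 -> y = x.
Proof. by move=> xy; rewrite -[RHS]addr0 -xy addrA addrr_F2 add0r. Qed.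

Lemma disjointsU1 (x : T) s A :
  [disjoint x |: s & A] = (x \notin A) && [disjoint s & A].
Proof. by rewrite -setI_eq0 setIUl setU_eq0 !setI_eq0 disjoints1. Qed.

(** The pairs (x, y) and (y, x) cancel mod 2; [enum_rank] singles out one of the two. *)
Lemma sum_symmetric_F2 (g : T -> T -> 'F_2) :
  (forall x y, g x y = g y x) -> \sum_x \sum_(y | y != x) g x y = 0.
Proof.
move=> gC.
have split_ne x : \sum_(y | y != x) g x y =
    \sum_(y | (enum_rank y < enum_rank x)%N) g x y
    + \sum_(y | (enum_rank x < enum_rank y)%N) g x y.
  rewrite (bigID (fun y => (enum_rank y < enum_rank x)%N)) /=.
  congr (_ + _); apply: eq_bigl => y; case: eqVneq => [->|ne] /=.
  - by rewrite ltnn.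
  - by [].
  - by rewrite ltnn.
  - rewrite -leqNgt leq_eqVlt; case: eqP => // e.
    by case/eqP: ne; apply/esym/enum_rank_inj/val_inj.
under eq_bigr do rewrite split_ne.
rewrite big_split /= [X in _ + X](exchange_big_dep predT) //= -big_split big1 //= => x _.
by under [X in _ + X]eq_bigr do rewrite gC; rewrite addrr_F2.
Qed.

Lemma bdry_funE c s : bdry_fun c s = \sum_(x | x \notin s) c (x |: s).
Proof. by rewrite ffunE. Qed.

Lemma bdry_bdry c : bdry_fun (bdry_fun c) = 0.
Proof.
apply/ffunP => s; rewrite bdry_funE [RHS]ffunE.
pose g x y := if (x \notin s) && (y \notin s) then c (y |: (x |: s)) else 0.
rewrite -[RHS](@sum_symmetric_F2 g) => [|x y]; last first.
  by rewrite /g andbC setUCA.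
rewrite big_mkcond; apply: eq_bigr => x _.
rewrite /g; case: ifP => xs /=; last by rewrite big1.
rewrite bdry_funE big_mkcond [RHS]big_mkcond; apply: eq_bigr => y _.
by rewrite !inE negb_or; case: eqP => //= _; case: ifP.
Qed.

Definition supported K k c :=
  forall s, c s != 0 -> s \in K /\ #|s| = k.

Lemma chainsP K k c : reflect (supported K k c) (c \in chains K k).
Proof.
apply: (iffP idP) => [cK s | cK].
  rewrite (coord_span cK) sum_ffunE; apply: contraNP => sK.
  rewrite big1 // => i _; rewrite ffunE.
  set x : chain_space T := nth _ _ _.
  have : x \in [seq elementary_chain s | s in [set s in K | #|s| == k]].
    by apply: mem_nth; rewrite size_map -cardE.
  case/mapP => t.
  rewrite mem_enum inE => /andP[tK /eqP tk] ->; rewrite ffunE.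
  by case: eqP => [st|]; rewrite ?scaler0 //; case: sK; rewrite st.
have -> : c = \sum_(s in [set s in K | #|s| == k]) c s *: elementary_chain s.
  apply/ffunP => t; rewrite sum_ffunE.
  under eq_bigr => s _ do rewrite !ffunE.
  have [ct|/cK[tK tk]] := eqVneq (c t) 0.
    rewrite big1 // => s _; case: eqP => [<-|_]; rewrite ?ct ?scaler0 ?scale0r //.
  rewrite (bigD1 t) /= ?inE ?tK ?tk ?eqxx // big1 ?addr0 => [|s /andP[_ ne]].
    exact/esym/mulr1.
  by rewrite eq_sym (negbTE ne) scaler0.
apply: memv_suml => s sK; apply/memvZ/memv_span/mapP.
by exists s; rewrite ?mem_enum.
Qed.

Definition is_cycle K k c := supported K k c /\ bdry_fun c = 0.

Lemma cyclesP K k c : reflect (is_cycle K k c) (c \in cycles K k).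
Proof.
by rewrite memv_cap memv_ker lfunE; apply: (iffP andP) => -[/chainsP ? /eqP ?].
Qed.

(** Sphere homology expressed by explicit cycles and fillings, which can be carried through a join.
    There is no face above cardinality N, hence no boundary to divide by there, and a line over F_2
    consists of 0 and [z] only. *)
Definition sphere_like N K :=
  [/\ simplicial_complex K,
      forall s, s \in K -> (#|s| <= N)%N,
      forall k c, k <> N -> is_cycle K k c ->
        exists2 e, supported K k.+1 e & bdry_fun e = c &
      exists z, [/\ is_cycle K N z, z <> 0 &
        forall c, is_cycle K N c -> c = 0 \/ c = z]].

Lemma sphere_like_betti N K k :
  sphere_like N K -> reduced_betti K k = (k == N).
Proof.
case=> _ leN acyc [z [zcyc /eqP z0 zU]]; rewrite /reduced_betti.
case: eqP => [->|/acyc {}acyc]; last first.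
  apply/eqP; rewrite subn_eq0 dimvS //; apply/subvP => c /cyclesP /acyc[e eK <-].
  by rewrite -(lfunE (@bdry_fun T)) memv_img //; apply/chainsP.
have -> : cycles K N = <[z]>%VS.
  apply/vspaceP => c; apply/cyclesP/vlineP => [/zU[]->|[a ->]].
  - by exists 0; rewrite scale0r.
  - by exists 1; rewrite scale1r.
  - case: zcyc => zK bz; split => [s|]; last by rewrite linearZ /= bz scaler0.
    rewrite ffunE => az; apply: zK; apply: contra az => /eqP->.
    by rewrite scaler0.
have -> : boundaries K N = 0%VS.
  apply/eqP; rewrite -subv0; apply/subvP => c /memv_imgP[e /chainsP eK ->].
  suff -> : e = 0 by rewrite linear0 mem0v.
  apply/ffunP => s; rewrite ffunE; apply: contraTeq isT => /eK[/leN + sN].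
  by rewrite sN ltnn.
by rewrite !dim_vline eqxx subn0; congr nat_of_bool; exact: z0.
Qed.

Lemma supported_bdry K k e :
  simplicial_complex K -> supported K k.+1 e -> supported K k (bdry_fun e).
Proof.
move=> [_ Kdown] eK s; rewrite bdry_funE.
case: (pickP (fun x => (x \notin s) && (e (x |: s) != 0))) => [x|no].
  case/andP=> xs /eK[xsK]; rewrite cardsU1 xs => -[<-] _; split=> //.
  by apply: Kdown xsK _; apply: subsetUr.
by rewrite big1 ?eqxx // => x xs; have /= := no x; rewrite xs => /negbFE/eqP.
Qed.

(** When the faces of [K] avoid [A], this is the join of [K] with the boundary of the simplex on
    [A]. *)
Definition join_bdry A K : {set {set T}} :=
  [set t : {set T} | ~~ (A \subset t) && (t :\: A \in K)].

(** * Join with the boundary of one simplex *)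

Section Join.
Variables (A : {set T}) (a : T) (K : {set {set T}}) (N : nat).
Hypotheses (aA : a \in A) (KA : forall t : {set T}, t \in K -> [disjoint t & A]).
Hypothesis KS : sphere_like N K.

Let J := join_bdry A K.

Lemma join_bdry_complex : simplicial_complex J.
Proof.
have [[K0 Kdown] _ _ _] := KS; split=> [|s t].
  by rewrite inE set0D K0 andbT; apply/subsetPn; exists a; rewrite ?inE.
rewrite !inE => /andP[At tK] st; rewrite (Kdown _ _ tK) ?setSD // andbT.
by apply: contra At => AS; apply: fintype.subset_trans AS st.
Qed.

(* The cone over a fills in every cycle whose faces all stay in J when a is
   added. *)
Lemma join_bdry_cone k c : is_cycle J k c ->
    (forall t, t :&: A = A :\ a -> c t = 0) ->
  exists2 e, supported J k.+1 e & bdry_fun e = c.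
Proof.
move=> [cJ bc] c0.
exists [ffun t : {set T} => if a \in t then c (t :\ a) else 0] => [t|].
  rewrite ffunE; case: ifP => [at_|_]; last by rewrite eqxx.
  move=> ct; have [] := cJ _ ct; rewrite !inE => /andP[_ tK] <-.
  rewrite (cardsD1 a t) at_; split=> //.
  have -> : t :\: A = t :\ a :\: A.
    by apply/setP => x; rewrite !inE; case: eqP => // ->; rewrite aA.
  rewrite tK andbT; apply: contra ct => At; apply/eqP/c0.
  apply/setP => x; rewrite !inE -andbA; case: (boolP (x \in A)) => xA.
    by rewrite (fintype.subsetP At x xA).
  by rewrite !andbF.
apply/ffunP => s; rewrite bdry_funE; case: (boolP (a \in s)) => as_.
  (* For [a] in [s], the cycle condition at [s :\ a] expresses [c s] by the other cofaces of
     [s :\ a]. *)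
  have /(congr1 (fun f : chain_space T => f (s :\ a))) := bc.
  rewrite bdry_funE [RHS]ffunE (bigD1 a) /= ?inE ?eqxx // setD1K //.
  move/addr0_eq_F2 => <-.
  apply: eq_big => [x|x xs].
    by rewrite !inE negb_and negbK; case: (eqVneq x a) => [->|]; rewrite ?as_ ?andbT.
  rewrite ffunE !inE as_ orbT; congr (c _); apply/setP => y; rewrite !inE.
  by case: (eqVneq y a) => // ->; rewrite orbF; apply/esym/eqP => /esym ax;
     move: xs; rewrite ax as_.
rewrite (bigD1 a) //= big1 ?addr0 => [|x /andP[xs xa]].
  by rewrite ffunE setU11 setU1K.
by rewrite ffunE !inE (negbTE as_) orbF eq_sym (negbTE xa).
Qed.

(* The part of a chain on the faces that become non-faces when a is added; it
   induces an isomorphism between the homologies of J and K. *)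
Definition residue c : chain_space T :=
  [ffun t : {set T} => if [disjoint t & A] then c ((A :\ a) :|: t) else 0].

(** The cycle condition is read at [A :\ a :|: t]: adding [a] yields [A :|: t], which is not a face,
    and the remaining terms form the boundary of the residue at [t]. *)
Lemma cycle_residue k c : is_cycle J (#|A|.-1 + k) c -> is_cycle K k (residue c).
Proof.
move=> [cJ bc]; have a1 : A :\ a :\: A = set0.
  by apply/eqP; rewrite setD_eq0 subsetDl.
split=> [t|].
  rewrite ffunE; case: ifP => [tA ct|]; last by rewrite eqxx.
  have [] := cJ _ ct; rewrite inE setDUl a1 set0U (setDidPl tA) => /andP[_ tK].
  rewrite cardsU [#|A|](cardsD1 a) aA /=.
  suff -> : (A :\ a) :&: t = set0 by rewrite cards0 subn0 => /addnI.
  apply/eqP; rewrite setI_eq0 disjoint_sym; apply: disjointWr tA.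
  exact: subsetDl.
apply/ffunP => t; rewrite bdry_funE [RHS]ffunE.
case: (boolP [disjoint t & A]) => tA; last first.
  rewrite big1 // => x _; rewrite ffunE ifF //; apply: contraNF tA.
  by apply: disjointWl; apply: subsetUr.
have := congr1 (fun f : chain_space T => f (A :\ a :|: t)) bc.
rewrite bdry_funE [RHS]ffunE; apply: etrans; apply/esym.
have a_t : a \notin t by apply: contraTN aA => at_; rewrite (disjointFr tA at_).
rewrite (bigD1 a) /=; last by rewrite !inE eqxx.
rewrite setUA setD1K //.
have -> : c (A :|: t) = 0.
  by apply: contraTeq isT => /cJ[]; rewrite inE subsetUl.
rewrite add0r [RHS](bigID (mem A)) /= [X in _ = X + _]big1 ?add0r; last first.
  by move=> x /andP[xt xA]; rewrite ffunE ifF // disjointsU1 xA.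
apply: eq_big => [x|x].
  rewrite !inE negb_or negb_and negbK; case: (eqVneq x a) => [->|_] /=.
    by rewrite aA andbF.
  by rewrite andbT andbC.
rewrite !inE => /andP[xAt xa]; rewrite ffunE disjointsU1 tA andbT.
have xA : x \notin A by move: xAt; rewrite negb_or negb_and xa; case/andP.
by rewrite xA setUCA.
Qed.

Lemma residueE c t : t :&: A = A :\ a -> c t = residue c (t :\: A).
Proof.
move=> tA; rewrite ffunE ifT -?tA ?setID // -setI_eq0.
by apply/eqP/setP => x; rewrite !inE; case: (x \in A); rewrite ?andbF.
Qed.

Lemma residue_small k c : (k < #|A|.-1)%N -> supported J k c -> residue c = 0.
Proof.
move=> kA cJ; apply/ffunP => t; rewrite !ffunE; case: ifP => // _.
apply: contraTeq kA => /cJ[_ <-]; rewrite -leqNgt.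
by rewrite [#|A|](cardsD1 a) aA /= subset_leq_card // subsetUl.
Qed.

(** The join of [e] with the single facet [A :\ a]; its boundary serves to cancel a given
    residue. *)
Definition join_facet e : chain_space T :=
  [ffun t : {set T} => if t :&: A == A :\ a then e (t :\: A) else 0].

Lemma supported_join_facet k e :
  supported K k e -> supported J (#|A|.-1 + k) (join_facet e).
Proof.
move=> eK t; rewrite ffunE; case: ifP => [/eqP tA|]; last by rewrite eqxx.
move=> /eK[tK <-]; split; last first.
  by rewrite -(cardsID A t) tA [#|A|](cardsD1 a) aA.
rewrite inE tK andbT; apply/subsetPn; exists a => //.
by move/setP/(_ a): tA; rewrite !inE aA eqxx andbT => ->.
Qed.

(** The boundary consists of terms that drop a vertex of [A :\ a], invisible to [residue], and of
    the join of [A :\ a] with the boundary of [e]. *)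
Lemma residue_bdry_join_facet k e :
  supported K k e -> residue (bdry_fun (join_facet e)) = bdry_fun e.
Proof.
move=> eK; apply/ffunP => t; rewrite ffunE.
have eA s : ~~ [disjoint s & A] -> e s = 0.
  by apply: contraNeq => /eK[/KA].
case: ifP => tA; last first.
  rewrite bdry_funE big1 // => x _; apply: eA; apply: contraFN tA.
  by apply: disjointWl; apply: subsetUr.
rewrite !bdry_funE [RHS](bigID (mem A)) /= [X in _ = X + _]big1 ?add0r; last first.
  by move=> x /andP[xt xA]; rewrite eA // disjointsU1 xA.
have a_t : a \notin t by apply: contraTN aA => at_; rewrite (disjointFr tA at_).
rewrite (bigD1 a) /=; last by rewrite !inE eqxx.
rewrite ffunE setUA setD1K // setUK.
rewrite ifF ?add0r; last by apply/eqP => /setP/(_ a); rewrite !inE aA eqxx.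
apply: eq_big => [x|x].
  rewrite !inE negb_or negb_and negbK; case: (eqVneq x a) => [->|_] /=.
    by rewrite aA andbF.
  by rewrite andbT andbC.
rewrite !inE => /andP[xAt xa].
have xA : x \notin A by move: xAt; rewrite negb_or negb_and xa; case/andP.
rewrite ffunE ifT; last first.
  apply/eqP/setP => y; rewrite !inE; case: (boolP (y \in A)) => yA.
    rewrite !andbT (disjointFl tA yA) orbF; case: eqP => // yx.
    by rewrite -yx yA in xA.
  by rewrite !andbF.
congr (e _); apply/setP => y; rewrite !inE; case: (boolP (y \in A)) => yA /=.
  rewrite (disjointFl tA yA) orbF; case: eqP => // yx; by rewrite -yx yA in xA.
by rewrite andbF.
Qed.

Lemma residueB c e : residue (c - e) = residue c - residue e.
Proof.
by apply/ffunP => t; rewrite !ffunE; case: ifP => _; rewrite ?subr0 ?ffunE //.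
Qed.

Lemma cycleB L k c e : is_cycle L k c -> is_cycle L k e -> is_cycle L k (c - e).
Proof.
move=> /cyclesP cL /cyclesP eL; apply/cyclesP; exact: memvB.
Qed.

(** The join of [z] with the fundamental cycle of the simplex boundary, the sum of all facets of
    [A]. *)
Definition join_cycle z : chain_space T :=
  [ffun t : {set T} => if #|A :\: t| == 1%N then z (t :\: A) else 0].

(** At [t], adding vertices outside [A] gives the boundary of [z], which is zero. Adding a vertex of
    [A] matters only if [t] misses exactly two of them, and those two terms are equal and cancel. *)
Lemma cycle_join_cycle k z : is_cycle K k z -> is_cycle J (#|A|.-1 + k) (join_cycle z).
Proof.
move=> [zK bz].
have zA s : ~~ [disjoint s & A] -> z s = 0.
  by apply: contraNeq => /zK[/KA].
split=> [t|].
  rewrite ffunE; case: ifP => [/eqP At|]; last by rewrite eqxx.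
  move=> /zK[tK <-]; rewrite inE tK andbT; split.
    by rewrite -setD_eq0 -cards_eq0 At.
  by rewrite -(cardsID A t) -(cardsID t A) At addn1 setIC.
apply/ffunP => t; rewrite bdry_funE [RHS]ffunE (bigID (mem A)) /=.
have -> : \sum_(x | (x \notin t) && (x \notin A)) join_cycle z (x |: t) = 0.
  under eq_bigr => x /andP[_ xA].
    rewrite ffunE (_ : A :\: (x |: t) = A :\: t); last first.
      by apply/setP => y; rewrite !inE; case: eqP => // ->; rewrite (negbTE xA) !andbF.
    rewrite (_ : (x |: t) :\: A = x |: (t :\: A)); last first.
      by apply/setP => y; rewrite !inE; case: eqP => // ->; rewrite xA.
    over.
  case: (#|A :\: t| == 1%N); last by rewrite big1.
  have := congr1 (fun f : chain_space T => f (t :\: A)) bz.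
  rewrite bdry_funE [RHS]ffunE; apply: etrans; apply/esym.
  rewrite (bigID (mem A)) /= big1 ?add0r; last first.
    by move=> x /andP[_ xA]; rewrite zA // disjointsU1 xA.
  by apply: eq_bigl => x; rewrite !inE; case: (x \in A); rewrite /= ?andbF ?andbT.
rewrite addr0.
have [At|At] := eqVneq #|A :\: t| 2%N; last first.
  rewrite big1 // => x /andP[xt xA]; rewrite ffunE ifF //.
  apply: contra_neqF At => /eqP e.
  by rewrite (cardsD1 x) !inE xA xt add1n -e setDDl setUC.
rewrite (eq_bigr (fun=> z (t :\: A))) => [|x /andP[xt xA]]; last first.
  rewrite ffunE ifT; last first.
    by move: At; rewrite (cardsD1 x) !inE xA xt add1n setDDl setUC => -[->].
  congr (z _); apply/setP => y; rewrite !inE; case: eqP => // ->.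
  by rewrite xA.
rewrite sumr_const (_ : #|_| = 2%N) ?mulr2n ?addrr_F2 //.
by rewrite -At; apply: eq_card => x; rewrite !inE.
Qed.

Lemma residue_join_cycle k z : supported K k z -> residue (join_cycle z) = z.
Proof.
move=> zK; apply/ffunP => t; rewrite ffunE.
have zA s : ~~ [disjoint s & A] -> z s = 0.
  by apply: contraNeq => /zK[/KA].
case: ifP => tA; last by rewrite zA ?tA.
rewrite ffunE (_ : A :\: _ = [set a]) ?cards1 ?eqxx.
  congr (z _); apply/setP => y; rewrite !inE; case: (boolP (y \in A)) => yA /=.
    by rewrite (disjointFl tA yA).
  by rewrite andbF.
apply/setP => y; rewrite !inE; case: (boolP (y \in A)) => yA /=.
  by rewrite (disjointFl tA yA) orbF !andbT; case: eqP.
by rewrite andbF; case: eqP yA => // ->; rewrite aA.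
Qed.

(** A cycle with zero residue is filled by the cone over [a]. Any other cycle outside the top
    cardinality is first corrected by the boundary of [join_facet e'], where [e'] fills its residue
    in [K]. *)
Lemma join_bdry_sphere_like : sphere_like (#|A|.-1 + N) J.
Proof.
have [_ KN acyc [z [zcyc z0 zU]]] := KS.
have Jcx := join_bdry_complex.
have JN s : s \in J -> (#|s| <= #|A|.-1 + N)%N.
  rewrite inE => /andP[As sK]; rewrite -(cardsID A s) leq_add ?KN //.
  have sub : s :&: A \proper A by rewrite properE subsetIr subsetI subxx andbT.
  by rewrite -ltnS prednK ?proper_card // (cardsD1 a) aA.
split=> // [k c kN cJ|].
  (* A face with fewer than [#|A|.-1] vertices cannot contain [A :\ a], so the residue is zero. *)
  have [kA|kA] := ltnP k #|A|.-1.
    apply: (join_bdry_cone cJ) => t tA; rewrite (residueE _ tA).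
    by rewrite (residue_small kA) ?ffunE //; case: cJ.
  move: kN cJ; rewrite -(subnKC kA); move: (k - _)%N => k' kN cJ.
  have [|e' e'K be'] := acyc k' (residue c) _ (cycle_residue cJ).
    by move=> k'N; apply: kN; rewrite k'N.
  have eJ := supported_join_facet e'K.
  rewrite addnS in eJ.
  have beJ : is_cycle J (#|A|.-1 + k') (bdry_fun (join_facet e')).
    by split; [apply: supported_bdry | rewrite bdry_bdry].
  have [t tA|e1 e1J be1] := join_bdry_cone (cycleB cJ beJ).
    by rewrite (residueE _ tA) residueB (residue_bdry_join_facet e'K) be' subrr ffunE.
  exists (e1 + join_facet e'); last by rewrite linearD /= be1 subrK.
  by apply/chainsP/memvD; apply/chainsP.
exists (join_cycle z); split; first exact: cycle_join_cycle.
  move=> jz; apply: z0; rewrite -(residue_join_cycle (proj1 zcyc)) jz.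
  by apply/ffunP => t; rewrite !ffunE if_same.
(* In the top cardinality the cone would live on faces that are too large, so it is zero: [residue]
   is injective on these cycles. *)
have zero c : is_cycle J (#|A|.-1 + N) c -> residue c = 0 -> c = 0.
  move=> cJ c0; have [t tA|e eJ <-] := join_bdry_cone cJ.
    by rewrite (residueE _ tA) c0 ffunE.
  suff -> : e = 0 by rewrite linear0.
  apply/ffunP => s; rewrite ffunE; apply: contraTeq isT => /eJ[/JN + sN].
  by rewrite sN ltnn.
move=> c cJ; have [c0|cz] := zU _ (cycle_residue cJ).
  by left; apply: zero.
right; apply/eqP; rewrite -subr_eq0; apply/eqP/zero.
  exact/cycleB/cycle_join_cycle.
by rewrite residueB cz (residue_join_cycle (proj1 zcyc)) subrr.
Qed.

End Join.

(** The sphere of dimension -1, neutral for joins, is the base of the induction below. *)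
Lemma sphere_like_set0 : sphere_like 0 [set set0].
Proof.
split=> [|s|k c k0 [cK _]|].
- by split=> [|s t]; rewrite !inE // => /eqP->; rewrite subset0.
- by rewrite inE => /eqP->; rewrite cards0.
- have -> : c = 0.
    apply/ffunP => s; rewrite ffunE; apply: contraTeq isT => /cK[].
    by rewrite inE => /eqP-> /esym; rewrite cards0.
  by exists 0; [move=> s; rewrite ffunE eqxx | rewrite linear0].
exists (elementary_chain set0); split.
- split=> [s|].
    rewrite ffunE inE; case: (eqVneq s set0) => [->|]; last by rewrite eqxx.
    by rewrite cards0.
  apply/ffunP => s; rewrite bdry_funE [RHS]ffunE big1 // => x _; rewrite ffunE.
  by case: eqP => // /setP/(_ x); rewrite !inE eqxx.
- by move/ffunP/(_ set0); rewrite !ffunE eqxx.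
move=> c [cK _].
have cE s : s != set0 -> c s = 0.
  by apply: contraNeq => /cK[]; rewrite inE.
have : c set0 = 0 \/ c set0 = 1.
  by case: (c set0) => -[|[|//]] ? ; [left|right]; apply: val_inj.
case=> c0; [left|right]; apply/ffunP => s; rewrite ffunE;
  by case: (eqVneq s set0) => [->|/cE].
Qed.

(** Induction with one join per set; top cardinalities add. A singleton is allowed and contributes
    the sphere of dimension -1, a case that occurs in links. *)
Lemma join_boundaries_sphere_like (As : seq {set T}) :
    pairwise (fun A B => [disjoint A & B]) As -> all (fun A => A != set0) As ->
  sphere_like (\sum_(A <- As) #|A|.-1)
    [set t : {set T} | (t \subset \bigcup_(A <- As) A)
                       && all (fun A => ~~ (A \subset t)) As].
Proof.
elim: As => [|A As IH] /=.
  move=> _ _; rewrite big_nil; have := sphere_like_set0; congr sphere_like.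
  by apply/setP => t; rewrite !inE big_nil subset0 andbT.
move=> /andP[/allP dA pAs] /andP[/set0Pn[a aA] nAs]; rewrite big_cons.
set K := finset _ in IH; have KA t : t \in K -> [disjoint t & A].
  rewrite inE => /andP[tA _]; apply: disjointWl tA _.
  rewrite disjoint_sym bigcup_seq; apply: bigcup_disjoint => B /dA.
  by [].
have := join_bdry_sphere_like aA KA (IH pAs nAs); congr sphere_like.
apply/setP => t; rewrite !inE big_cons subDset.
rewrite andbCA; congr (_ && (_ && _)).
apply: eq_in_all => B /dA; rewrite disjoint_sym => AB.
by rewrite subsetD AB andbT.
Qed.

End Homology.

(** * Free sums of simplices *)

Section ConvexHulls.
Variables (R : realType) (d n : nat) (q : 'I_n -> 'rV[R]_d).

Lemma mulmx_comb (I : finType) (w : I -> R) (f : I -> 'rV[R]_d) (a : 'cV[R]_d) :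
  ((\sum_i w i *: f i) *m a) 0 0 = \sum_i w i * (f i *m a) 0 0.
Proof.
rewrite mulmx_suml summxE; apply: eq_bigr => i _.
by rewrite -scalemxAl mxE.
Qed.

Lemma conv_hull_point i : conv_hull q (q i).
Proof.
exists (fun j => (j == i)%:R); split=> [j||].
- by rewrite ler0n.
- by rewrite (bigD1 i) //= eqxx big1 ?addr0 // => j /negbTE->.
rewrite (bigD1 i) //= eqxx scale1r big1 ?addr0 // => j /negbTE->.
by rewrite scale0r.
Qed.

Lemma conv_hull_le (a : 'cV[R]_d) b x :
  (forall i, (q i *m a) 0 0 <= b) -> conv_hull q x -> (x *m a) 0 0 <= b.
Proof.
move=> qb [w [w0 w1 ->]]; rewrite mulmx_comb -[b]mul1r -w1 mulr_suml.
by apply: ler_sum => i _; apply: ler_wpM2l.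
Qed.

(** If a convex combination attains the bound, the non-negative gaps below [b], weighted by [w], sum
    to zero, so [w] vanishes outside [s]. *)
Lemma conv_hull_exposed (a : 'cV[R]_d) b (s : {set 'I_n}) :
    (forall i, (q i *m a) 0 0 <= b) ->
    (forall i, (i \in s) = ((q i *m a) 0 0 == b)) ->
  [set x | conv_hull q x /\ (x *m a) 0 0 = b]%classic
  = conv_hull (fun k : 'I_#|s| => q (enum_val k)).
Proof.
move=> qb sE; apply/seteqP; split=> x /=.
  case=> -[w [w0 w1 ->]] xb.
  have w_out i : i \notin s -> w i = 0.
    move=> is_; have gap0 : \sum_i w i * (b - (q i *m a) 0 0) == 0.
      under eq_bigr do rewrite mulrBr.
      by rewrite sumrB -mulr_suml w1 mul1r -mulmx_comb xb subrr.
    move: gap0; rewrite psumr_eq0 => [/allP/(_ i)|j _]; last first.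
      by rewrite mulr_ge0 // subr_ge0.
    rewrite mem_index_enum mulf_eq0 subr_eq0 eq_sym [b == _]eq_sym -sE (negbTE is_) orbF.
    by move=> /(_ isT)/eqP.
  exists (fun k => w (enum_val k)); split=> //.
    rewrite -[RHS]w1 [RHS](bigID (mem s)) /= [X in _ + X]big1 ?addr0 => [|i /w_out //].
    by rewrite [RHS]big_enum_val.
  rewrite (bigID (mem s)) /= [X in _ + X]big1 ?addr0 => [|i /w_out ->]; last first.
    by rewrite scale0r.
  by rewrite big_enum_val.
case=> w [w0 w1 ->]; split; last first.
  rewrite mulmx_comb -[RHS]mul1r -w1 mulr_suml; apply: eq_bigr => k _.
  by have := enum_valP k; rewrite sE => /eqP->.
(* Conversely, weights on [s] are pushed forward to all indices, with value 0 outside [s]. *)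
pose w' i := \sum_(k | enum_val k == i :> 'I_n) w k.
have w'E (V : lmodType R) (f : 'I_n -> V) :
    \sum_i w' i *: f i = \sum_k w k *: f (enum_val k).
  under eq_bigr do rewrite scaler_suml.
  rewrite (exchange_big_dep predT) //=; apply: eq_bigr => k _.
  by under eq_bigl do rewrite eq_sym; rewrite big_pred1_eq.
exists w'; split=> [i||]; first exact: sumr_ge0.
  have := w'E R^o (fun=> 1); rewrite /GRing.scale /=.
  by under eq_bigr do rewrite mulr1; under [in RHS]eq_bigr do rewrite mulr1; rewrite w1.
by rewrite w'E.
Qed.

(** After appending a column of ones, d + 2 rows lie in dimension d + 1; a nonzero left kernel
    vector is an affine dependence. *)
Lemma affine_dependence (f : 'I_d.+2 -> 'rV[R]_d) : ~ affinely_independent f.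
Proof.
move=> indep; pose A := \matrix_(i < d.+2) f i.
pose M := row_mx A (const_mx 1 : 'cV_d.+2).
have /rowV0Pn[v /sub_kermxP vM v0] : kermx M != 0.
  rewrite kermx_eq0 -row_leq_rank -ltnNge (leq_ltn_trans (rank_leq_col M)) //.
  by rewrite addn1.
move: vM; rewrite mul_mx_row -row_mx0 => /eq_row_mx[vA v1].
case/negP: v0; apply/eqP/rowP => i; rewrite mxE.
apply: (indep (v 0)).
  have /rowP/(_ 0) := v1; rewrite !mxE => e; rewrite -[RHS]e.
  by apply: eq_bigr => k _; rewrite mxE mulr1.
rewrite -[RHS]vA mulmx_sum_row; apply: eq_bigr => k _.
by rewrite rowK.
Qed.

End ConvexHulls.

(** * Points, faces and vertices of a free sum *)

Section FreeSum.
Variables (R : realType) (d r : nat) (blk : 'I_d -> 'I_r).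

Definition block_of (v : 'I_(d + r)) : 'I_r :=
  match split v with inl j => blk j | inr i => i end.

Definition block (i : 'I_r) : {set 'I_(d + r)} := [set v | block_of v == i].

(** [lshift r j] is the basis vector e_j, and [rshift d i] is an apex, minus the sum of the e_j of
    block i. Each block thus spans a simplex around the origin in its own coordinate subspace. *)
Definition vpoint (v : 'I_(d + r)) : 'rV[R]_d :=
  \row_j ((v == lshift r j)%:R - (v == rshift d (blk j))%:R).

Lemma block_of_lshift j : block_of (lshift r j) = blk j.
Proof. by rewrite /block_of -[lshift r j]/(unsplit (inl _)) unsplitK. Qed.

Lemma block_of_rshift i : block_of (rshift d i) = i.
Proof. by rewrite /block_of -[rshift d i]/(unsplit (inr _)) unsplitK. Qed.

Lemma sum_delta (V : lmodType R) (v : 'I_(d + r)) (f : 'I_(d + r) -> V) :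
  \sum_u (u == v)%:R *: f u = f v.
Proof.
by rewrite (bigD1 v) //= eqxx scale1r big1 ?addr0 // => u /negbTE->; rewrite scale0r.
Qed.

(** Values lie in any module so that [f] can be the weights of a combination of points as well as
    the partial derivatives of a stress. *)
Lemma sum_point_coord (V : lmodType R) (f : 'I_(d + r) -> V) j :
  \sum_v vpoint v 0 j *: f v = f (lshift r j) - f (rshift d (blk j)).
Proof.
under eq_bigr do rewrite mxE scalerBl.
by rewrite sumrB !sum_delta.
Qed.

Lemma comb_pointE (w : 'I_(d + r) -> R) j :
  (\sum_v w v *: vpoint v) 0 j = w (lshift r j) - w (rshift d (blk j)).
Proof.
rewrite -(sum_point_coord (w : _ -> R^o)) summxE; apply: eq_bigr => v _.
by rewrite mxE mulrC.
Qed.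

Lemma sum_block_point i : \sum_(v in block i) vpoint v = 0.
Proof.
transitivity (\sum_v (v \in block i)%:R *: vpoint v).
  rewrite big_mkcond; apply: eq_bigr => v _.
  by case: (v \in block i); rewrite ?scale1r ?scale0r.
by apply/rowP => j; rewrite comb_pointE !inE block_of_lshift block_of_rshift subrr mxE.
Qed.

Lemma sum_block (V : zmodType) (f : 'I_(d + r) -> V) i :
  \sum_(v in block i) f v
  = \sum_(j | blk j == i) f (lshift r j) + f (rshift d i).
Proof.
rewrite big_split_ord /=; congr (_ + _).
  by apply: eq_bigl => j; rewrite inE block_of_lshift.
by rewrite (eq_bigl (pred1 i)) ?big_pred1_eq // => k; rewrite inE block_of_rshift.
Qed.

Lemma card_block i : #|block i| = #|[set j | blk j == i]|.+1.
Proof.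
rewrite -sum1_card big_split_ord /= -sum1dep_card -[RHS]addn1; congr (_ + _)%N.
  by apply: eq_bigl => j; rewrite inE block_of_lshift.
by rewrite (eq_bigl (pred1 i)) ?big_pred1_eq // => k; rewrite inE block_of_rshift.
Qed.

(** The values on basis vectors may be chosen freely, and a zero block sum is what linearity imposes
    on the apex. *)
Lemma point_functional (u : 'I_(d + r) -> R) :
    (forall i, \sum_(v in block i) u v = 0) ->
  forall v, (vpoint v *m \col_j u (lshift r j)) 0 0 = u v.
Proof.
move=> u0 v; rewrite mxE; under eq_bigr do rewrite !mxE mulrBl.
rewrite sumrB; case: (split_ordP v) => k ->.
  rewrite (bigD1 k) //= eqxx mul1r [X in _ + X - _]big1 => [|j jk]; last first.
    by rewrite (inj_eq (@lshift_inj _ _)) eq_sym (negbTE jk) mul0r.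
  by rewrite big1 ?addr0 ?subr0 // => j _; rewrite eq_lrshift mul0r.
rewrite big1 ?sub0r => [|j _]; last by rewrite eq_rlshift mul0r.
have /eqP := u0 k; rewrite sum_block addrC addr_eq0 => /eqP->; congr (- _).
rewrite [RHS]big_mkcond; apply: eq_bigr => j _.
rewrite (inj_eq (@rshift_inj _ _)) eq_sym.
by case: eqP; rewrite ?mul1r ?mul0r.
Qed.

Definition block_free (s : {set 'I_(d + r)}) : bool :=
  [forall i, ~~ (block i \subset s)].

Implicit Types s : {set 'I_(d + r)}.

Lemma block_freeP s : reflect (forall i, ~~ (block i \subset s)) (block_free s).
Proof. exact: forallP. Qed.

Lemma block_free_exposed s : block_free s ->
  exists a : 'cV[R]_d,
    (forall v, (vpoint v *m a) 0 0 <= 1) /\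
    (forall v, (v \in s) = ((vpoint v *m a) 0 0 == 1)).
Proof.
move=> /block_freeP sfree.
(* The functional is 1 on [s]; [- t i] is the constant value on the rest of block i that makes the
   block sum zero. The denominator is nonzero because [s] contains no block. *)
pose t i := #|block i :&: s|%:R / #|block i :\: s|%:R : R.
pose u v := if v \in s then 1 else - t (block_of v).
exists (\col_j u (lshift r j)).
have t0 i : 0 <= t i by rewrite divr_ge0 ?ler0n.
have uE v : (vpoint v *m \col_j u (lshift r j)) 0 0 = u v.
  apply: point_functional => i; rewrite (big_setID s) /=.
  rewrite (eq_bigr (fun=> 1)) => [|x /setIP[_ xs]]; last by rewrite /u xs.
  rewrite [X in _ + X](eq_bigr (fun=> - t i)) => [|x]; last first.
    by rewrite !inE /u => /andP[/negbTE-> /eqP->].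
  rewrite !sumr_const mulNrn -[t i *+ _]mulr_natr /t divfK ?subrr //.
  by rewrite pnatr_eq0 cards_eq0 setD_eq0.
split=> v; rewrite uE /u; case: (v \in s); rewrite ?eqxx // ; have := t0 (block_of v).
  by lra.
by move=> tv; apply/esym/negbTE/eqP; lra.
Qed.

(** Coordinate j forces equal weights on e_j and the apex of its block, so a dependence is constant
    on each block, and each block has a vertex outside [s]. *)
Lemma block_free_independent s (w : 'I_(d + r) -> R) : block_free s ->
    (forall v, v \notin s -> w v = 0) -> \sum_v w v *: vpoint v = 0 ->
  forall v, w v = 0.
Proof.
move=> /block_freeP sfree ws wp.
have w_rep v : w v = w (rshift d (block_of v)).
  case: (split_ordP v) => j ->; last by rewrite block_of_rshift.
  rewrite block_of_lshift; apply/eqP; rewrite -subr_eq0 -comb_pointE wp.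
  by rewrite mxE.
move=> v; have /fintype.subsetPn[x] := sfree (block_of v).
by rewrite inE => /eqP xv /ws; rewrite w_rep xv -w_rep.
Qed.

Definition sum_of_simplices : set 'rV[R]_d := conv_hull vpoint.

Definition subsimplex s : set 'rV[R]_d :=
  conv_hull (fun k : 'I_#|s| => vpoint (enum_val k)).

Local Notation P := sum_of_simplices.

(** A functional has zero sum on each block. If it is maximal on a whole block, the maximum is 0, so
    every value is 0 and the face is [P]; otherwise the set of maximal vertices is block free. *)
Lemma faces_of_sum F : is_face P F -> F = P \/
  exists s, [/\ block_free s, F = subsimplex s & forall v, v \in s <-> F (vpoint v)].
Proof.
move=> [a [b [Pb FE]]].
have pb v : (vpoint v *m a) 0 0 <= b by apply/Pb/conv_hull_point.
pose s := [set v | (vpoint v *m a) 0 0 == b].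
have sE v : (v \in s) = ((vpoint v *m a) 0 0 == b) by rewrite inE.
have sum0 i : \sum_(v in block i) (vpoint v *m a) 0 0 = 0.
  by rewrite -summxE -mulmx_suml sum_block_point mul0mx mxE.
have [sfree|] := boolP (block_free s).
  right; exists s; rewrite FE /subsimplex -(conv_hull_exposed pb sE); split=> // v.
  rewrite sE /=; split=> [/eqP|[_ ->]] //; split=> //; exact: conv_hull_point.
rewrite negb_forall => /existsP[i]; rewrite negbK => is_; left.
have b0 : b = 0.
  have := sum0 i; rewrite (eq_bigr (fun=> b)) => [|v vi]; last first.
    by apply/eqP; rewrite -sE (fintype.subsetP is_).
  rewrite sumr_const => /eqP; rewrite mulrn_eq0 card_block /=.
  by move/eqP.
have pa v : (vpoint v *m a) 0 0 = 0.
  have /eqP := sum0 (block_of v).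
  rewrite -oppr_eq0 -sumrN psumr_eq0 => [/allP/(_ v)|u _]; last first.
    by rewrite oppr_ge0 -b0.
  by rewrite mem_index_enum inE eqxx oppr_eq0 => /(_ isT)/eqP.
rewrite FE; apply/seteqP; split=> x /= => [[]//|Px]; split=> //.
case: Px => w [_ _ ->]; rewrite mulmx_comb b0 big1 // => v _.
by rewrite pa mulr0.
Qed.

Lemma subsimplex_face s : block_free s ->
  is_face P (subsimplex s) /\ forall v, v \in s <-> subsimplex s (vpoint v).
Proof.
move=> /block_free_exposed[a [a1 sE]].
rewrite /subsimplex -(conv_hull_exposed a1 sE); split=> [|v].
  by exists a, 1; split=> // x; apply: conv_hull_le.
by rewrite sE; split=> [/eqP|[_ ->]] //; split=> //; exact: conv_hull_point.
Qed.

Hypotheses (d_gt0 : (0 < d)%N) (blk_surj : forall i, exists j, blk j = i).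

Lemma subsimplex_proper s : block_free s -> proper_face P (subsimplex s).
Proof.
move=> sfree; have [sface sE] := subsimplex_face sfree; split=> // sP.
have /fintype.subsetPn[v _ /negP vs] := block_freeP _ sfree (blk (Ordinal d_gt0)).
by apply: vs; apply/sE; rewrite sP; apply: conv_hull_point.
Qed.

Lemma mem_boundary_complex s :
  (s \in boundary_complex P vpoint) = block_free s.
Proof.
rewrite inE; apply/asboolP/idP => [[F [/faces_of_sum[//|[s' [s'free _ s'E]] _]]] sE|].
  rewrite (_ : s = s') //; apply/setP => v.
  by apply/idP/idP => [/sE/s'E|/s'E/sE].
move=> sfree; exists (subsimplex s); first exact: subsimplex_proper.
by have [] := subsimplex_face sfree.
Qed.

Lemma simplicial_sum : simplicial_polytope P.
Proof.
split; first by exists (d + r)%N, vpoint.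
move=> F [/faces_of_sum[//|[s [sfree -> _]]] _].
exists #|s|, (fun k => vpoint (enum_val k)); split=> // w _ w0 k.
pose w' v := \sum_(k | enum_val k == v :> 'I_(d + r)) w k.
have w'E : \sum_v w' v *: vpoint v = 0.
  rewrite -[RHS]w0; under eq_bigr do rewrite scaler_suml.
  rewrite (exchange_big_dep predT) //=; apply: eq_bigr => l _.
  by under eq_bigl do rewrite eq_sym; rewrite big_pred1_eq.
have := block_free_independent sfree _ w'E (enum_val k).
rewrite /w' (eq_bigl (pred1 k)) ?big_pred1_eq; last first.
  by move=> l; rewrite /= (inj_eq enum_val_inj).
apply=> v vs; rewrite big1 // => l /eqP lv.
by have := enum_valP l; rewrite lv (negbTE vs).
Qed.

(** Surjectivity of [blk] gives each block a basis vector besides its apex, hence at least two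
    vertices. *)
Lemma block_free1 v : block_free [set v].
Proof.
apply/block_freeP => i; apply/negP => /subset_leq_card.
rewrite card_block cards1 ltnS leqn0 cards_eq0 => /eqP/setP.
by have [j <-] := blk_surj i => /(_ j); rewrite !inE eqxx.
Qed.

Lemma point_inj : injective vpoint.
Proof.
move=> v v' vv'; have [_ vE] := subsimplex_face (block_free1 v).
have : v' \in [set v] by apply/vE; rewrite -vv'; apply/vE; rewrite inE.
by rewrite inE => /eqP.
Qed.

Lemma vertices_sum : range vpoint = vertices P.
Proof.
apply/seteqP; split=> x /=.
  case=> v _ <-; have [+ _] := subsimplex_face (block_free1 v).
  rewrite /vertices /=; congr (is_face P _); rewrite /subsimplex.
  have vk (k : 'I_#|[set v]|) : enum_val k = v.
    by have := enum_valP k; rewrite inE => /eqP.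
  apply/seteqP; split=> y /=.
    case=> w [_ w1 ->]; under eq_bigr do rewrite vk.
    by rewrite -scaler_suml w1 scale1r.
  move=> ->; have k : 'I_#|[set v]| by rewrite cards1; exact: ord0.
  by have := conv_hull_point (fun j : 'I_#|[set v]| => vpoint (enum_val j)) k; rewrite vk.
(* If the one-point face is all of [P], every [vpoint] equals x; otherwise weights summing to 1 show
   that [s] is nonempty, and any member of [s] gives x. *)
move=> xface; have [xP|[s [_ sE sx]]] := faces_of_sum xface.
  have eqx v : vpoint v = x.
    by have : P (vpoint v) by [exact: conv_hull_point]; rewrite -xP.
  exists (lshift r (Ordinal d_gt0)) => //.
have : subsimplex s x by rewrite -sE.
case=> w [_ w1 _].
have [k _|s0] := pickP (fun _ : 'I_#|s| => true); last first.
  move: w1; rewrite big1 => [/eqP|k]; first by rewrite eq_sym oner_eq0.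
  by have := s0 k.
by exists (enum_val k) => //; apply: (proj1 (sx _) (enum_valP k)).
Qed.

Lemma natural_embedding_sum : natural_embedding P vpoint.
Proof. by split; [exact: point_inj | exact: vertices_sum]. Qed.

Lemma zero_in_sum : P 0.
Proof.
pose i := blk (Ordinal d_gt0).
have ci : (#|block i|%:R : R) != 0 by rewrite pnatr_eq0 card_block.
exists (fun v => (v \in block i)%:R / #|block i|%:R); split=> [v||].
- by rewrite divr_ge0 ?ler0n.
- rewrite -mulr_suml (_ : \sum_v _ = #|block i|%:R) ?divff //.
  rewrite -sum1_card natr_sum [RHS]big_mkcond; apply: eq_bigr => v _.
  by case: (v \in block i).
under eq_bigr do rewrite mulrC -scalerA.
rewrite -scaler_sumr (_ : \sum_v _ = 0) ?scaler0 //.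
rewrite -[RHS](sum_block_point i) [RHS]big_mkcond; apply: eq_bigr => v _.
by case: (v \in block i); rewrite ?scale1r ?scale0r.
Qed.

(** The witnesses are the origin, which is the barycentre of a block, and the d basis vectors. *)
Lemma has_dim_sum : has_dim P d.
Proof.
split; last by move=> q _; apply: affine_dependence.
exists (fun k => if unlift ord0 k is Some j then vpoint (lshift r j) else 0).
split=> [k|w w1 w0].
  case: unlift => [j|]; [exact: conv_hull_point | exact: zero_in_sum].
have wS j : w (lift ord0 j) = 0.
  have := congr1 (fun x : 'rV_d => x 0 j) w0.
  rewrite big_ord_recl unlift_none scaler0 add0r summxE mxE => e; rewrite -[RHS]e.
  rewrite (bigD1 j) //= liftK !mxE eqxx eq_lrshift subr0 mulr1.
  rewrite big1 ?addr0 // => k kj; rewrite liftK !mxE (inj_eq (@lshift_inj _ _)).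
  by rewrite (negbTE kj) eq_lrshift subr0 mulr0.
move=> k; case: (unliftP ord0 k) => [j|] ->; first exact: wS.
by move: w1; rewrite big_ord_recl big1 ?addr0.
Qed.

End FreeSum.

(** * Links and missing faces of the boundary complex *)

Section Sphere.
Variables (R : realType) (d r : nat) (blk : 'I_d -> 'I_r).
Hypotheses (d_gt0 : (0 < d)%N) (blk_surj : forall i, exists j, blk j = i).

Local Notation block := (block blk).
Local Notation vpoint := (vpoint R blk).
Local Notation K := (boundary_complex (@sum_of_simplices R _ _ blk) vpoint).
Implicit Types s : {set 'I_(d + r)}.

Lemma disjoint_block i j : i != j -> [disjoint block i & block j].
Proof.
move=> ij; rewrite -setI_eq0; apply/eqP/setP => v; rewrite !inE.
by case: eqP => //= ->; apply/negbTE.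
Qed.

Lemma sum_card_block s : (\sum_i #|block i :\: s| = d + r - #|s|)%N.
Proof.
have <- : #|~: s| = (d + r - #|s|)%N.
  by rewrite -(addKn #|s| #|~: s|) cardsC card_ord.
rewrite -[RHS]sum1_card (partition_big (block_of blk) predT) //=.
apply: eq_bigr => i _; rewrite -sum1_card; apply: eq_bigl => v.
by rewrite !inE.
Qed.

(** [s :|: t] contains block i iff [t] contains [block i :\: s], so a link is again a join of
    simplex boundaries, on the truncated blocks. *)
Lemma link_boundary_complex s :
  link K s = [set t : {set 'I_(d + r)} |
     (t \subset \bigcup_(A <- [seq block i :\: s | i <- enum 'I_r]) A)
     && all (fun A : {set 'I_(d + r)} => ~~ (A \subset t))
            [seq block i :\: s | i <- enum 'I_r]].
Proof.
have -> : \bigcup_(A <- [seq block i :\: s | i <- enum 'I_r]) A = ~: s.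
  rewrite big_map big_enum /=; apply/setP => v; rewrite inE.
  apply/bigcupP/idP => [[i _ /setDP[]] // | vs].
  by exists (block_of blk v); rewrite // !inE vs eqxx.
apply/setP => t; rewrite in_set [RHS]in_set mem_boundary_complex //.
rewrite disjoint_sym disjoints_subset; congr (_ && _).
rewrite all_map; apply/block_freeP/allP => [h i _ | h i]; rewrite ?subDset //=.
  by rewrite subDset.
by have := h i; rewrite mem_enum /= subDset; apply.
Qed.

(** The truncated blocks are nonempty and have d + r - #|s| vertices in total; subtracting one for
    each of the r blocks leaves d - #|s|. *)
Lemma link_sphere_like s : s \in K -> sphere_like (d - #|s|) (link K s).
Proof.
rewrite mem_boundary_complex // => /block_freeP sfree.
rewrite link_boundary_complex.
have pos i : (0 < #|block i :\: s|)%N by rewrite card_gt0 setD_eq0.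
have -> : (d - #|s| =
    \sum_(A <- [seq block i :\: s | i <- enum 'I_r]) #|A|.-1)%N.
  rewrite big_map big_enum /=; apply/eqP; rewrite -(eqn_add2r r).
  have -> : (\sum_i #|block i :\: s|.-1 + r = \sum_i #|block i :\: s|)%N.
    rewrite -[X in (_ + X)%N](card_ord r) -sum1_card -big_split /=.
    by apply: eq_bigr => i _; rewrite addn1 prednK.
  have := sum_card_block s; have : (r <= \sum_i #|block i :\: s|)%N.
    rewrite -[X in (X <= _)%N](card_ord r) -sum1_card; apply: leq_sum => i _.
    exact: pos.
  move: (max_card s); rewrite card_ord; move: (\sum_i _)%N #|s| => S k.
  by move=> *; apply/eqP; lia.
apply: join_boundaries_sphere_like.
  rewrite pairwise_map; apply: sub_pairwise (_ : pairwise (fun i j => i != j) _).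
    move=> i j /disjoint_block dij /=; apply: disjointWl (subsetDl _ _) _.
    exact: disjointWr (subsetDl _ _) dij.
  by rewrite -uniq_pairwise enum_uniq.
by rewrite all_map; apply/allP => i _ /=; rewrite -card_gt0.
Qed.

Lemma boundary_complex_complex : simplicial_complex K.
Proof.
split=> [|s t]; rewrite !mem_boundary_complex //.
  apply/block_freeP => i; rewrite subset0 -cards_eq0 card_block.
  by [].
move=> /block_freeP tfree st; apply/block_freeP => i.
by apply: contra (tfree i) => is_; apply: fintype.subset_trans is_ st.
Qed.

Lemma card_boundary_complex s : s \in K -> (#|s| <= d)%N.
Proof.
rewrite mem_boundary_complex // => /block_freeP sfree.
have := sum_card_block s.
have : (r <= \sum_i #|block i :\: s|)%N.
  rewrite -[X in (X <= _)%N](card_ord r) -sum1_card; apply: leq_sum => i _.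
  by rewrite card_gt0 setD_eq0.
move: (max_card s); rewrite card_ord; move: (\sum_i _)%N #|s| => S k.
by lia.
Qed.

Lemma boundary_complex_sphere : homology_sphere d.-1 K.
Proof.
split; first exact: boundary_complex_complex.
  rewrite prednK //; apply/eqP; rewrite eqn_leq; apply/andP; split.
    by apply/bigmax_leqP => s; apply: card_boundary_complex.
  (* The basis vectors form a facet: every block lacks its apex. *)
  pose s := [set lshift r j | j : 'I_d].
  have sd : #|s| = d by rewrite card_imset ?card_ord //; exact: lshift_inj.
  rewrite -[X in (X <= _)%N]sd; apply: leq_bigmax_cond.
  rewrite mem_boundary_complex //; apply/block_freeP => i.
  apply/fintype.subsetPn; exists (rshift d i); first by rewrite inE block_of_rshift.
  by apply/imsetP => -[j _ /eqP]; rewrite eq_rlshift.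
by move=> s /link_sphere_like sK k; rewrite prednK //; apply: sphere_like_betti.
Qed.

Lemma missing_face_boundary_complex s : missing_face K s -> exists i, s = block i.
Proof.
case=> _; rewrite mem_boundary_complex // negb_forall => /existsP[i].
rewrite negbK => is_ smin; exists i; apply/esym/eqP.
apply: contraT => ne; have := smin (block i).
rewrite properEneq ne is_ mem_boundary_complex // => /(_ isT)/block_freeP/(_ i).
by rewrite subxx.
Qed.

Lemma boundary_complex_in_S j :
  (forall i, #|block i| <= j.+1)%N -> in_S j d.-1 K.
Proof.
move=> bj; split; first exact: boundary_complex_sphere.
by move=> s /missing_face_boundary_complex[i ->]; rewrite -ltnS prednK ?bj ?card_block.
Qed.

End Sphere.

(** * Affine stresses of free sums of simplices *)

Section Derivatives.
Variables (R : realType) (n : nat).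
Implicit Types (f : {mpoly R[n]}) (l : seq 'I_n).

Lemma foldr_mderivC v f l :
  mderiv v (foldr (@mderiv n R) f l) = foldr (@mderiv n R) (mderiv v f) l.
Proof. by elim: l => //= u l IH; rewrite mderiv_comm IH. Qed.

(** [c] is the product of the exponents brought down by differentiation; its positivity lets
    vanishing pass between derivative and coefficient. *)
Lemma foldr_mderiv_coef f l mu :
  exists2 c, (0 < c)%N &
    (foldr (@mderiv n R) f l)@_mu = f@_(mu + \sum_(v <- l) U_(v))%MM *+ c.
Proof.
elim: l mu => [|v l IH] mu /=.
  by exists 1%N; rewrite // big_nil addm0 mulr1n.
have [c c0 E] := IH (mu + U_(v))%MM; exists (c * (mu v).+1)%N.
  by rewrite muln_gt0 c0.
by rewrite mcoeff_deriv E big_cons addmA mulrnA.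
Qed.

(** By degree, the only monomial of degree #|tau| whose support contains [tau] is the squarefree
    one. *)
Lemma homog_participates k f (tau : {set 'I_n}) : f \is k.-homog -> #|tau| = k ->
  participates tau f -> f@_(\sum_(v <- enum tau) U_(v))%MM != 0.
Proof.
move=> /dhomogP fk tk [mu muf tmu]; rewrite -mcoeff_msupp.
suff <- : mu = (\sum_(v <- enum tau) U_(v))%MM by [].
have E v : (\sum_(u <- enum tau) U_(u))%MM v = (v \in tau).
  rewrite mnm_sumE big_enum /=; under eq_bigr do rewrite mnm1E.
  rewrite big_mkcond (bigD1 v) //= eqxx big1 => [|u uv]; first by case: ifP.
  by rewrite (negbTE uv); case: ifP.
have le_mu v : ((v \in tau) <= mu v)%N.
  case: (boolP (v \in tau)) => // vt.
  by have := fintype.subsetP tmu v vt; rewrite inE lt0n.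
(* The truncated subtraction is exact by [le_mu], so the sum is the degree minus #|tau|. *)
have : (\sum_v (mu v - (v \in tau)) = 0)%N.
  rewrite sumnB //; have := fk _ muf; rewrite /= mdegE => ->.
  rewrite -tk -sum1_card big_mkcond /=.
  by rewrite (eq_bigr (fun v => nat_of_bool (v \in tau))) ?subnn // => v _; case: ifP.
move/eqP; rewrite sum_nat_eq0 => /forallP mu0; apply/mnmP => v; rewrite E.
by apply/eqP; rewrite eqn_leq le_mu andbT -subn_eq0; apply: (implyP (mu0 v)).
Qed.

End Derivatives.

(** * Block derivatives of a stress *)

Section Stress.
Variables (R : realType) (d r : nat) (blk : 'I_d -> 'I_r).
Hypotheses (d_gt0 : (0 < d)%N) (blk_surj : forall i, exists j, blk j = i).

Local Notation block := (block blk).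
Local Notation vpoint := (vpoint R blk).
Local Notation K := (boundary_complex (@sum_of_simplices R _ _ blk) vpoint).

Variables (k : nat) (f : {mpoly R[d + r]}).
Hypothesis fstress : affine_stress K vpoint k f.

(** By [sum_point_coord], the condition for [theta] at j says that the derivatives along e_j and
    along the apex of its block agree. *)
Lemma stress_mderiv v : mderiv v f = mderiv (rshift d (block_of blk v)) f.
Proof.
case: (split_ordP v) => j ->; last by rewrite block_of_rshift.
rewrite block_of_lshift; apply/eqP; rewrite -subr_eq0.
have [_ _ /(_ j) fj _] := fstress; rewrite -[X in _ == X]fj.
rewrite -(sum_point_coord blk (fun v => mderiv v f)); apply/eqP/eq_bigr => u _.
congr (_ *: _); rewrite /theta raddf_sum /= (bigD1 u) //= big1 ?addr0 => [|w wu].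
  by rewrite mcoeffZ mcoeffXU eqxx mulr1.
by rewrite mcoeffZ mcoeffXU (negbTE wu) mulr0.
Qed.

(* the constant term of the derivative of f along one vertex of each block
   listed in l, with repetitions *)
Definition block_deriv (l : seq 'I_r) : R :=
  (foldr (@mderiv (d + r) R) f [seq rshift d i | i <- l])@_0%MM.

Lemma block_derivE (l : seq 'I_(d + r)) :
  (foldr (@mderiv (d + r) R) f l)@_0%MM = block_deriv [seq block_of blk v | v <- l].
Proof.
rewrite /block_deriv; congr (_@__); elim: l => //= v l <-.
by rewrite !foldr_mderivC stress_mderiv.
Qed.

Lemma block_deriv_perm l l' : perm_eq l l' -> block_deriv l = block_deriv l'.
Proof.
by move=> ll'; rewrite /block_deriv (mderiv_perm _ (perm_map _ ll')).
Qed.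

(** The derivatives listed in [l] are applied to the condition on [sum_of_variables]; the vertices
    of a block contribute equally. *)
Lemma block_deriv_sum l : \sum_i #|block i|%:R * block_deriv (i :: l) = 0.
Proof.
have [_ _ _ fc] := fstress.
have : (foldr (@mderiv (d + r) R) (\sum_v mderiv v f) [seq rshift d i | i <- l])@_0%MM = 0.
  have -> : \sum_v mderiv v f = 0.
    rewrite -[RHS]fc; apply: eq_bigr => v _; rewrite -[LHS]scale1r; congr (_ *: _).
    rewrite /sum_of_variables raddf_sum /= (bigD1 v) //= big1 ?addr0 => [|w wv].
      by rewrite mcoeffXU eqxx.
    by rewrite mcoeffXU (negbTE wv).
  have -> : foldr (@mderiv (d + r) R) 0 [seq rshift d i | i <- l] = 0.
    by elim: l => //= i l ->; rewrite mderiv0.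
  exact: mcoeff0.
have -> : foldr (@mderiv (d + r) R) (\sum_v mderiv v f) [seq rshift d i | i <- l]
   = \sum_v foldr (@mderiv (d + r) R) (mderiv v f) [seq rshift d i | i <- l].
  by elim: l => //= i l ->; rewrite raddf_sum.
rewrite raddf_sum /= (partition_big (block_of blk) predT) //= => e; rewrite -[RHS]e.
apply: eq_bigr => i _; rewrite (eq_bigr (fun=> block_deriv (i :: l))).
  rewrite sumr_const mulr_natl; congr (_ *+ _); apply: eq_card => v.
  by rewrite !inE.
by move=> v /eqP vi; rewrite stress_mderiv vi /block_deriv /= foldr_mderivC.
Qed.

(** By [block_derivE] the repeated apex derivatives can be spread over all vertices of the block. A
    contributing monomial would have the whole block in its support, which is not a face. *)
Lemma block_deriv_eq0 i l : block_deriv (nseq #|block i| i ++ l) = 0.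
Proof.
have := block_derivE (enum (block i) ++ [seq rshift d j | j <- l]).
rewrite map_cat -map_comp (eq_map (g := id)); last first.
  by move=> j /=; rewrite block_of_rshift.
rewrite map_id (_ : [seq block_of blk v | v <- enum (block i)] = nseq #|block i| i).
  move=> <-; set vs := _ ++ _; have [c _ ->] := foldr_mderiv_coef f vs 0%MM.
  rewrite add0m; suff -> : f@_(\sum_(v <- vs) U_(v))%MM = 0 by rewrite mul0rn.
  apply: contraTeq isT; rewrite -mcoeff_msupp.
  have [_ fK _ _] := fstress => /fK; rewrite mem_boundary_complex //.
  move=> /block_freeP/(_ i)/negP[]; apply/fintype.subsetP => v vi; rewrite inE.
  rewrite mnm_sumE /vs big_cat /= (big_rem v) /= ?mem_enum // mnm1E eqxx.
  by rewrite -!addnA.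
apply: (@eq_from_nth _ i); rewrite size_map -cardE ?size_nseq // => j jl.
rewrite nth_nseq jl; pose v0 := rshift d i.
rewrite (nth_map v0) -?cardE //; apply/eqP.
have : nth v0 (enum (block i)) j \in enum (block i) by rewrite mem_nth -?cardE.
by rewrite mem_enum inE.
Qed.

End Stress.

(* Up to the alternating sign and the factor x ^+ (2 - l), for fixed i + j the
   values at level l are those of a polynomial in i of degree 2 - l; the one at level 1 vanishes
   at i = m because its sum over 0 <= i <= 2 m does. *)
Lemma recurrence_middle_eq0 (R : realType) (m : nat) (a b : R)
    (G : nat -> nat -> nat -> R) :
    a != 0 -> b != 0 ->
    (forall i j l, a * G i.+1 j l + a * G i j.+1 l + b * G i j l.+1 = 0) ->
    G (2 * m).+1 0 0 = 0 -> G 0 (2 * m).+1 0 = 0 -> (forall i j, G i j 3 = 0) ->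
  G m m 1 = 0.
Proof.
move=> a0 b0 rec Gl Gr G3; pose x := b / a.
have {}rec i j l : G i.+1 j l = - G i j.+1 l - x * G i j l.+1.
  apply: (mulfI a0); rewrite mulrBr mulrA [a * x]mulrC divfK //.
  by have := rec i j l; lra.
have x0 : x != 0 by rewrite mulf_neq0 ?invr_eq0.
have G2 i j : G i j 2 = (-1) ^+ i * G 0 (i + j)%N 2.
  elim: i j => [|i IH] j; first by rewrite expr0 mul1r.
  by rewrite rec G3 IH exprS addSnnS; ring.
(* The truncated predecessors here and in [G0] are harmless: whenever truncation occurs, the
   coefficient is zero. *)
have G1 i j : G i j 1
    = (-1) ^+ i * (G 0 (i + j)%N 1 + i%:R * x * G 0 (i + j).-1%N 2).
  elim: i j => [|i IH] j; first by rewrite expr0; ring.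
  rewrite rec (G2 i) IH exprS addSnnS addnS /=; ring.
(* The factor 2 clears the denominator of the binomial coefficient i (i - 1) / 2. *)
have G0 i j : 2 * G i j 0 = (-1) ^+ i *
    (2 * G 0 (i + j)%N 0 + x * (2 * i%:R * G 0 (i + j).-1%N 1
       + i%:R * (i%:R - 1) * x * G 0 (i + j).-2%N 2)).
  elim: i j => [|i IH] j; first by rewrite expr0; ring.
  rewrite rec (G1 i) mulrBr mulrN IH exprS addSnnS addnS /=; ring.
(* Both level 0 values in this instance vanish. What remains is x times 2 (2m + 1) times the bracket
   in [G1] at i = j = m. *)
have := G0 (2 * m).+1 0%N; rewrite Gl addn0 Gr /= mulr0 => /esym/eqP.
rewrite mulf_eq0 signr_eq0 /= add0r mulf_eq0 (negbTE x0) /= => /eqP e.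
rewrite G1 addnn -mul2n; apply/eqP; rewrite mulf_eq0 signr_eq0 /=; apply/eqP.
have m1 : 2 * (2 * m).+1%:R != 0 :> R by rewrite mulf_neq0 ?pnatr_eq0.
apply: (mulfI m1); rewrite mulr0 -[RHS]e; ring.
Qed.

Lemma sum_interval (d a b : nat) :
  (\sum_(k < d) ((a <= k < b) : nat) = minn d b - a)%N.
Proof.
elim: d => [|d IH]; first by rewrite big_ord0 min0n.
by rewrite big_ord_recr /= IH; lia.
Qed.

Lemma card_interval (d : nat) (A : {set 'I_d}) (a b : nat) :
  (forall k : 'I_d, (k \in A) = (a <= k < b)%N) -> #|A| = (minn d b - a)%N.
Proof.
move=> AE; rewrite -sum_interval -sum1_card big_mkcond.
by apply: eq_bigr => k _; rewrite AE; case: ifP.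
Qed.

(** * Two large blocks, a triangle and the balanced face *)

Section ThreeBlocks.
Variables (R : realType) (m : nat).
Hypothesis m_gt0 : (0 < m)%N.

Local Notation d := (4 * m + 2)%N.

Let i0 : 'I_3 := @Ordinal 3 0 isT.
Let i1 : 'I_3 := @Ordinal 3 1 isT.
Let i2 : 'I_3 := @Ordinal 3 2 isT.

Definition three_blocks (k : 'I_d) : 'I_3 :=
  if (k < 2 * m)%N then i0 else if (k < 4 * m)%N then i1 else i2.

Local Notation block := (block three_blocks).
Local Notation vpoint := (vpoint R three_blocks).
Local Notation K := (boundary_complex (@sum_of_simplices R _ _ three_blocks) vpoint).

Lemma ord3P (i : 'I_3) : [\/ i = i0, i = i1 | i = i2].
Proof.
by case: i => -[|[|[|//]]] ?; [constructor 1 | constructor 2 | constructor 3];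
   apply: val_inj.
Qed.

Lemma card_three_blocks i :
  #|block i| = (if i == i2 then 3 else (2 * m).+1)%N.
Proof.
rewrite card_block; have [->|->|->] /= := ord3P i; congr _.+1.
- rewrite (@card_interval _ _ 0 (2 * m)); first by lia.
  by move=> k; rewrite inE /three_blocks; do ?case: ifP => *;
     rewrite -(inj_eq val_inj) /=; lia.
- rewrite (@card_interval _ _ (2 * m) (4 * m)); first by lia.
  by move=> k; rewrite inE /three_blocks; do ?case: ifP => *;
     rewrite -(inj_eq val_inj) /=; lia.
- rewrite (@card_interval _ _ (4 * m) d); first by lia.
  by move=> k; rewrite inE /three_blocks; have := ltn_ord k; do ?case: ifP => *;
     rewrite -(inj_eq val_inj) /=; lia.
Qed.

Lemma three_blocks_surj i : exists j, three_blocks j = i.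
Proof.
have /card_gt0P[j] : (0 < #|[set j | three_blocks j == i]|)%N.
  by have := card_three_blocks i; rewrite card_block; case: ifP; lia.
by rewrite inE => /eqP; exists j.
Qed.

(** All its vertices are basis vectors, so every apex is left out and no block is contained in
    it. *)
Definition balanced_face : {set 'I_(d + 3)} :=
  [set v : 'I_(d + 3) | [|| (v < m)%N,
     (2 * m <= v < 3 * m)%N | (4 * m <= v < (4 * m).+1)%N]].

Lemma block_of_balanced v : v \in balanced_face ->
  block_of three_blocks v
  = if (v < 2 * m)%N then i0 else if (v < 4 * m)%N then i1 else i2.
Proof.
case: (split_ordP v) => k ->; first by rewrite block_of_lshift.
by rewrite inE /=; lia.
Qed.

Lemma count_balanced i :
  count_mem i [seq block_of three_blocks v | v <- enum balanced_face]
  = if i == i2 then 1%N else m.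
Proof.
rewrite count_map -sum1_count big_enum_cond /=.
rewrite (eq_bigl (mem [set v in balanced_face | block_of three_blocks v == i])); last first.
  by move=> v; rewrite !inE.
rewrite sum1_card.
have E v : (v \in [set v in balanced_face | block_of three_blocks v == i]) =
   (v \in balanced_face) && ((if (v < 2 * m)%N then i0 else
      if (v < 4 * m)%N then i1 else i2) == i).
  by rewrite in_set; case: (boolP (v \in balanced_face)) => // /block_of_balanced->.
have [ei|ei|ei] := ord3P i; rewrite ei in E *.
- rewrite (@card_interval _ _ 0 m) /=; first by lia.
  by move=> k; rewrite E inE; do ?case: ifP => *;
     rewrite -(inj_eq val_inj) /=; lia.
- rewrite (@card_interval _ _ (2 * m) (3 * m)) /=; first by lia.
  by move=> k; rewrite E inE; do ?case: ifP => *;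
     rewrite -(inj_eq val_inj) /=; lia.
- rewrite (@card_interval _ _ (4 * m) (4 * m).+1) /=; first by lia.
  by move=> k; rewrite E inE; do ?case: ifP => *;
     rewrite -(inj_eq val_inj) /=; lia.
Qed.

Lemma balanced_face_in : balanced_face \in K.
Proof.
rewrite mem_boundary_complex; last by lia.
apply/block_freeP => i; apply/fintype.subsetPn; exists (rshift d i).
  by rewrite inE block_of_rshift.
by rewrite inE /=; lia.
Qed.

Lemma balanced_perm :
  perm_eq [seq block_of three_blocks v | v <- enum balanced_face]
          (nseq m i0 ++ nseq m i1 ++ nseq 1 i2).
Proof.
apply/allP => i _ /=; rewrite count_balanced !count_cat !count_nseq /=.
by have [->|->|->] := ord3P i; rewrite /= ?mul1n ?mul0n ?addn0.
Qed.

Lemma card_balanced : #|balanced_face| = (2 * m).+1.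
Proof.
rewrite cardE -(size_map (block_of three_blocks)) (perm_size balanced_perm).
by rewrite !size_cat !size_nseq; lia.
Qed.

Lemma stress_balanced k f : affine_stress K vpoint k f ->
  block_deriv f (nseq m i0 ++ nseq m i1 ++ nseq 1 i2) = 0.
Proof.
move=> fstress; have d_gt0 : (0 < d)%N by lia.
pose G i j l := block_deriv f (nseq i i0 ++ nseq j i1 ++ nseq l i2).
(* The coefficients are the block sizes occurring in [block_deriv_sum]. *)
apply: (@recurrence_middle_eq0 R m (2 * m).+1%:R 3 G); rewrite ?pnatr_eq0 //.
- move=> i j l; have := block_deriv_sum fstress (nseq i i0 ++ nseq j i1 ++ nseq l i2).
  rewrite !big_ord_recl big_ord0 addr0 addrA.
  have -> : lift (@ord0 2) (lift (@ord0 1) (@ord0 0)) = i2 by apply: val_inj.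
  have -> : lift (@ord0 2) (@ord0 1) = i1 by apply: val_inj.
  have -> : @ord0 2 = i0 by apply: val_inj.
  rewrite !card_three_blocks /= => e; rewrite -[RHS]e.
  congr (_ * _ + _ * _ + _ * _); apply: block_deriv_perm.
  + by apply/permP => p; rewrite /= !count_cat /= !count_cat; lia.
  + by apply/permP => p; rewrite /= !count_cat /=; lia.
- have := block_deriv_eq0 d_gt0 fstress i0 [::].
  by rewrite card_three_blocks //.
- have := block_deriv_eq0 d_gt0 fstress i1 [::].
  by rewrite card_three_blocks //.
(* Three derivatives in the triangle exhaust that block. *)
move=> i j; rewrite -(block_deriv_eq0 d_gt0 fstress i2 (nseq i i0 ++ nseq j i1)).
rewrite card_three_blocks; apply: block_deriv_perm.
by apply/permP => p; rewrite eqxx !count_cat [RHS]addnC addnA.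
Qed.

End ThreeBlocks.

Theorem corollary6p11 (R : realType) (m : nat) (hm : (1 <= m)%N) :
  exists P : set 'rV[R]_(4 * m + 2),
    [/\ simplicial_polytope P,
        has_dim P (4 * m + 2) &
        exists (n : nat) (p : 'I_n -> 'rV[R]_(4 * m + 2)),
          [/\ natural_embedding P p,
              in_S (2 * m) (4 * m + 1) (boundary_complex P p) &
              exists tau : {set 'I_n},
                [/\ tau \in boundary_complex P p,
                    #|tau| = (2 * m).+1 &
                    forall lambda : {mpoly R[n]},
                      affine_stress (boundary_complex P p) p (2 * m + 1) lambda ->
                      ~ participates tau lambda]]].
Proof.
have d_gt0 : (0 < 4 * m + 2)%N by lia.
have surj := three_blocks_surj hm.
exists (@sum_of_simplices R _ _ (@three_blocks m)); split.
- exact: simplicial_sum.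
- exact: has_dim_sum.
exists (4 * m + 2 + 3)%N, (vpoint R (@three_blocks m)); split.
- exact: natural_embedding_sum.
- rewrite (_ : 4 * m + 1 = (4 * m + 2).-1)%N; last by lia.
  apply: boundary_complex_in_S => // i; rewrite card_three_blocks //.
  by case: ifP => _; lia.
exists (balanced_face m); split; [exact: balanced_face_in | exact: card_balanced |].
move=> f fstress tauf; have [fhom _ _ _] := fstress.
have := homog_participates fhom _ tauf; rewrite card_balanced // addn1 => /(_ erefl).
(* Up to the positive factor [c], the squarefree coefficient is a block derivative, which depends
   only on how many vertices lie in each block. *)
have [c c0] := foldr_mderiv_coef f (enum (balanced_face m)) 0%MM.
rewrite (block_derivE fstress) (block_deriv_perm _ (balanced_perm hm)).
rewrite (stress_balanced hm fstress) add0m => /esym/eqP.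
by rewrite mulrn_eq0 gtn_eqF // orFb => ->.
Qed.
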